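(* Let $(T,[-,-,-],\cdot)$ be a truss. (1) If $T$ is unital, with identity $1$ of $(T,\cdot)$, then the operations $+_1$ and $\cdot$ satisfy the left and right brace-type distributive laws, i.e. for all $x,y,z\in T$, $$x(y+_1z)=(xy)-_1x+_1(xz),\qquad (y+_1z)x=(yx)-_1x+_1(zx).$$ (2) If $0$ is an absorber of $T$, then $(T,+_0,\cdot)$ is a ring.
   Context: A heap is a non-empty set $H$ with a ternary operation $[-,-,-]$ satisfying $[v,w,[x,y,z]]=[[v,w,x],y,z]$ and $[x,x,y]=y=[y,x,x]$; it is Abelian if $[x,y,z]=[z,y,x]$. For an Abelian heap $H$ and $e\in H$, the operation $x+_e y=[x,e,y]$ makes $H$ into an Abelian group with neutral element $e$ and inverse $-_e x=[e,x,e]$. A truss is an Abelian heap $T$ with an associative binary operation $\cdot$ (juxtaposition) satisfying $w[x,y,z]=[wx,wy,wz]$ and $[x,y,z]w=[xw,yw,zw]$. It is unital if $(T,\cdot)$ is a monoid. An absorber is an element $0\in T$ with $x0=0=0x$ for all $x\in T$. Rings are associative but not assumed to have a multiplicative identity. *)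

(* Defs.v *)
From HB Require Import structures.
From mathcomp Require Import ssreflect ssrfun ssrbool.

Set Implicit Arguments.
Unset Strict Implicit.
Unset Printing Implicit Defensive.

Declare Scope truss_scope.
Delimit Scope truss_scope with truss.
Open Scope truss_scope.

Reserved Notation "[< x , y , z >]"
  (at level 0, x, y, z at level 99, format "[<  x ,  y ,  z  >]").
Reserved Notation "x +_[ e ] y"
  (at level 50, left associativity, format "x  +_[ e ]  y").
Reserved Notation "-_[ e ] x"
  (at level 35, right associativity, format "-_[ e ]  x").
Reserved Notation "x -_[ e ] y"
  (at level 50, left associativity, format "x  -_[ e ]  y").

HB.mixin Record isHeap H := {
  heap_op : H -> H -> H -> H;
  heap_inhabited : inhabited H;
  heapA : forall v w x y z : H,
    heap_op v w (heap_op x y z) = heap_op (heap_op v w x) y z;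
  heapKl : forall x y : H, heap_op x x y = y;
  heapKr : forall x y : H, heap_op y x x = y
}.

#[short(type="heapType")]
HB.structure Definition Heap := {H of isHeap H}.

Notation "[< x , y , z >]" := (heap_op x y z) : truss_scope.

HB.mixin Record Heap_isAbelian H of Heap H := {
  heapC : forall x y z : H, [< x, y, z >] = [< z, y, x >]
}.

#[short(type="abelianHeapType")]
HB.structure Definition AbelianHeap := {H of Heap_isAbelian H & Heap H}.

Definition heap_add (H : abelianHeapType) (e x y : H) : H := [< x, e, y >].
Definition heap_opp (H : abelianHeapType) (e x : H) : H := [< e, x, e >].

Notation "x +_[ e ] y" := (heap_add e x y) : truss_scope.
Notation "-_[ e ] x" := (heap_opp e x) : truss_scope.
Notation "x -_[ e ] y" := (heap_add e x (heap_opp e y)) : truss_scope.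

HB.mixin Record AbelianHeap_isTruss T of AbelianHeap T := {
  truss_mul : T -> T -> T;
  truss_mulA : associative truss_mul;
  truss_mulDr : forall w x y z : T,
    truss_mul w [< x, y, z >]
      = [< truss_mul w x, truss_mul w y, truss_mul w z >];
  truss_mulDl : forall w x y z : T,
    truss_mul [< x, y, z >] w
      = [< truss_mul x w, truss_mul y w, truss_mul z w >]
}.

#[short(type="trussType")]
HB.structure Definition Truss := {T of AbelianHeap_isTruss T & AbelianHeap T}.

Notation "x * y" := (truss_mul x y) : truss_scope.

(* As truss_mul is associative, a truss T is unital if and only if some u : T
   satisfies is_identity u. *)
Definition is_identity (T : trussType) (u : T) : Prop :=
  left_id u (@truss_mul T) /\ right_id u (@truss_mul T).

Definition is_absorber (T : trussType) (a : T) : Prop :=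
  forall x : T, x * a = a /\ a * x = a.

Definition is_abelian_group (A : Type) (add : A -> A -> A) : Prop :=
  [/\ associative add, commutative add
    & exists2 o : A, left_id o add & forall x : A, exists y : A, add y x = o].

(* MathComp's ring structures all have a multiplicative identity; the rings
   here need not have one. *)
Definition is_ring (A : Type) (add mul : A -> A -> A) : Prop :=
  [/\ is_abelian_group add, associative mul,
      left_distributive mul add & right_distributive mul add].

(* Main.v *)
Require Import Defs.
From mathcomp Require Import ssreflect ssrfun ssrbool.

(** Multiplication by [x] distributes over the bracket, so it sends [[< y, e, z >]] to a bracket
    whose middle entry is [x * e] or [e * x]. This entry is [x] if [e] is an identity, and [e]
    itself if [e] is an absorber. *)

(** Reassociation makes the base point [e] cancel against itself twice. *)
Lemma heap_addBD (H : abelianHeapType) (e x y z : H) :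
  x -_[e] y +_[e] z = [< x, y, z >].
Proof. by rewrite /heap_add /heap_opp heapA heapKr -heapA heapKl. Qed.

Lemma heap_add_abelian_group (H : abelianHeapType) (e : H) :
  is_abelian_group (heap_add e).
Proof.
split; [by move=> x y z; apply: heapA | by move=> x y; apply: heapC |].
exists e => [x | x]; first exact: heapKl.
by exists (-_[e] x); rewrite /heap_add /heap_opp -heapA heapKl heapKr.
Qed.

Theorem lemma3p9 (T : trussType) :
  (forall one : T, is_identity one ->
     forall x y z : T,
       x * (y +_[one] z) = (x * y) -_[one] x +_[one] (x * z) /\
       (y +_[one] z) * x = (y * x) -_[one] x +_[one] (z * x)) /\
  (forall zero : T, is_absorber zero ->
     is_ring (heap_add zero) (@truss_mul T)).
Proof.
split=> [one [mul1 mulr1] x y z | zero abs0].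
  (* Both sides become [[< x * y, x, x * z >]], or its mirror image. *)
  by rewrite !heap_addBD /heap_add truss_mulDr truss_mulDl mul1 mulr1.
split; [exact: heap_add_abelian_group | exact: truss_mulA | |].
(* The middle entry [zero * z] collapses to [zero]. *)
- by move=> x y z; rewrite /heap_add truss_mulDl (abs0 z).2.
- by move=> x y z; rewrite /heap_add truss_mulDr (abs0 x).1.
Qed.
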